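(* Let $G$ be a second countable locally compact Abelian group, let $E \in \mathcal{E}$, and let $\bigcup_{j\in J}\{T_\gamma g_{j,p}\}_{\gamma\in\Gamma_j,\,p\in P_j}$ be a generalised translation-invariant system in $L^2(G)$. Suppose that the system satisfies the Calderón integrability condition with respect to $E$, that the generating functions $\bigcup_{j\in J}\{g_{j,p}\}_{p\in P_j}$ are strictly temperate with respect to $E$, and that $(\Gamma_j)_{j\in J}$ satisfies the uniform counting estimate. Then $\bigcup_{j\in J}\{T_\gamma g_{j,p}\}_{\gamma\in\Gamma_j,\,p\in P_j}$ satisfies the local integrability condition with respect to $E$.
   Context: $G$ is a second countable locally compact Hausdorff Abelian group, written additively, with Haar measure $\mu_G$; $\widehat G$ is its Pontryagin dual, written multiplicatively, with the Plancherel Haar measure $\mu_{\widehat G}$ relative to $\mu_G$. $\hat f$ is the Fourier–Plancherel transform of $f\in L^2(G)$, and $T_\gamma f = f(\cdot-\gamma)$. For a closed subgroup $\Gamma\subseteq G$, $\Gamma^\perp=\{\omega\in\widehat G: \omega(x)=1\ \forall x\in\Gamma\}$. $\Gamma$ is co-compact if $G/\Gamma$ is compact. Each $\Gamma$ carries a given Haar measure $\mu_\Gamma$ (the counting measure if $\Gamma$ is a uniform lattice, i.e. discrete and co-compact), $G/\Gamma$ carries the Haar measure making Weil's formula $\int_G f\,d\mu_G=\int_{G/\Gamma}\int_\Gamma f(x+\gamma)\,d\mu_\Gamma(\gamma)\,d\mu_{G/\Gamma}(\dot x)$ hold, and the covolume is $\mathrm{d}(\Gamma)=\mu_{G/\Gamma}(G/\Gamma)$.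 Generalised translation-invariant (GTI) system: $J$ is countable; for each $j\in J$, $\Gamma_j\subseteq G$ is a closed, co-compact subgroup and $P_j$ is an index set with functions $g_{j,p}\in L^2(G)$, $p\in P_j$; the system is $\bigcup_{j\in J}\{T_\gamma g_{j,p}:\gamma\in\Gamma_j,p\in P_j\}$. Standing hypotheses for each $j$: (I) $(P_j,\Sigma_{P_j},\mu_{P_j})$ is a $\sigma$-finite measure space; (II) $p\mapsto g_{j,p}$ is measurable from $(P_j,\Sigma_{P_j})$ to $L^2(G)$ with its Borel $\sigma$-algebra; (III) $(p,x)\mapsto g_{j,p}(x)$ is $\Sigma_{P_j}\otimes\mathcal B_G$-measurable. $\mathcal E$ is the collection of closed sets $E\subseteq\widehat G$ of Haar measure zero. $\mathcal D_E(G)$ is the set of $f\in L^2(G)$ such that $\hat f\in L^\infty(\widehat G)$ has compact support $\operatorname{supp}\hat f\subseteq\widehat G\setminus E$. Local integrability condition (w.r.t. $E$): for all $f\in\mathcal D_E(G)$, $$\sum_{j\in J}\frac1{\mathrm{d}(\Gamma_j)}\int_{P_j}\sum_{\alpha\in\Gamma_j^\perp}\int_{\operatorname{supp}\hat f}|\hat f(\omega\alpha)\hat g_{j,p}(\omega)|^2\,d\mu_{\widehat G}(\omega)\,d\mu_{P_j}(p)<\infty.$$ Calderón integrability condition (w.r.t. $E$): $\sum_{j\in J}\frac1{\mathrm{d}(\Gamma_j)}\int_{P_j}|\hat g_{j,p}(\cdot)|^2\,d\mu_{P_j}(p)\in L^1_{\mathrm{loc}}(\widehat G\setminus E)$, i.e.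 it is integrable over every compact $K\subseteq\widehat G\setminus E$. Strictly temperate (w.r.t. $E$): $\sum_{j\in J}\int_{P_j}|\hat g_{j,p}(\cdot)|^2\,d\mu_{P_j}(p)\in L^1_{\mathrm{loc}}(\widehat G\setminus E)$. Uniform counting estimate: for every compact $K\subseteq\widehat G$ there is a constant $C=C(K)>0$ such that $\sup_{\omega\in\widehat G}\sum_{\alpha\in\Gamma_j^\perp}\mathbf 1_K(\omega\alpha)\le C(1+\mathrm{d}(\Gamma_j))$ for all $j\in J$. *)

(* Defs.v *)
From HB Require Import structures.
From mathcomp Require Import all_boot all_order all_algebra generic_quotient.
From mathcomp Require Import ring_quotient.
From mathcomp Require Import all_classical all_reals all_analysis.
From mathcomp Require Import measurable_realfun ess_sup_inf complex.

Set Implicit Arguments.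
Unset Strict Implicit.
Unset Printing Implicit Defensive.

Import Order.TTheory GRing.Theory Num.Theory.
Import Quotient.Exports.
Import numFieldNormedType.Exports.
Import ComplexField.

Local Open Scope classical_set_scope.
Local Open Scope ring_scope.

(* Measurable spaces are pointed in the library; a topological abelian group
   is pointed by its zero. *)
HB.instance Definition _ (G : topologicalZmodType) := isPointed.Build G 0.

Definition borel (T : ptopologicalType) : Type :=
  g_sigma_algebraType (@open T).
HB.instance Definition _ (T : ptopologicalType) := Measurable.on (borel T).

(* Finiteness on compact sets is the whole Radon condition for the groups
   considered here: they are all second countable and locally compact, so that
   regularity is automatic. *)
Definition is_haar (R : realType) (T : ptopologicalType) (op : T -> T -> T)
    (mu : {measure set (borel T) -> \bar R}) :=
  [/\ mu setT != 0%E,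
      forall K : set T, compact K -> (mu K < +oo)%E &
      forall (x : T) (A : set (borel T)), measurable A ->
        mu (op x @^-1` A) = mu A].

Section complex_functions.
Context d (T : measurableType d) (R : realType).
Variable mu : {measure set T -> \bar R}.
Implicit Types f : T -> R[i].

Definition sqnormc (z : R[i]) : R := Normc.normc z ^+ 2.

Definition cmeasurable f :=
  measurable_fun setT (fun x => complex.Re (f x)) /\
  measurable_fun setT (fun x => complex.Im (f x)).

Definition cintegral f : R[i] :=
  Complex (\int[mu]_x complex.Re (f x)) (\int[mu]_x complex.Im (f x)).

Definition isL1 f :=
  cmeasurable f /\ (\int[mu]_x (Normc.normc (f x))%:E < +oo)%E.

Definition isL2 f := cmeasurable f /\ (\int[mu]_x (sqnormc (f x))%:E < +oo)%E.

Definition L2dist2 f1 f2 : \bar R := (\int[mu]_x (sqnormc (f1 x - f2 x))%:E)%E.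

(* The open sets of L^2(mu), seen as sets of functions; such a set is stable
   under a.e. equality between square-integrable functions. *)
Definition L2open : set (set (T -> R[i]^o)) :=
  [set U | forall f, isL2 f -> U f ->
     exists2 e : R, 0 < e &
       forall h, isL2 h -> (L2dist2 h f < (e ^+ 2)%:E)%E -> U h].

End complex_functions.

Section dual.
Context (R : realType) (G : topologicalZmodType).

Record dual := Dual {
  dual_fun :> G -> R[i] ;
  dual_norm : forall x, Normc.normc (dual_fun x) = 1 ;
  dualD : forall x y, dual_fun (x + y) = dual_fun x * dual_fun y ;
  dual_continuous : continuous (dual_fun : G -> R[i]^o) }.

HB.instance Definition _ := gen_eqMixin dual.
HB.instance Definition _ := gen_choiceMixin dual.

Definition dual_compact_open (w : dual) : {compact-open, G -> R[i]^o} := w.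

HB.instance Definition _ :=
  Topological.copy dual (initial_topology dual_compact_open).

Lemma dual_eq (w1 w2 : dual) : w1 =1 w2 -> w1 = w2.
Proof.
case: w1 w2 => f1 n1 d1 c1 [f2 n2 d2 c2] /= /funext e; move: n1 d1 c1.
rewrite e => n1 d1 c1.
by rewrite (Prop_irrelevance n1 n2) (Prop_irrelevance d1 d2)
           (Prop_irrelevance c1 c2).
Qed.

Let one_norm (x : G) : Normc.normc (1 : R[i]) = 1.
Proof. exact: Normc.normc1. Qed.

Let oneD (x y : G) : (1 : R[i]) = 1 * 1.
Proof. by rewrite mulr1. Qed.

Let one_cont : continuous (cst 1 : G -> R[i]^o).
Proof. by move=> x; exact: cvg_cst. Qed.

Definition dual_one : dual := @Dual (cst 1) one_norm oneD one_cont.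

Let mul_norm (w1 w2 : dual) (x : G) : Normc.normc (w1 x * w2 x) = 1.
Proof. by rewrite Normc.normcM !dual_norm mulr1. Qed.

Let mulD (w1 w2 : dual) (x y : G) :
  w1 (x + y) * w2 (x + y) = (w1 x * w2 x) * (w1 y * w2 y).
Proof. by rewrite !dualD mulrACA. Qed.

Let mul_cont (w1 w2 : dual) :
  continuous ((fun x => w1 x * w2 x) : G -> R[i]^o).
Proof.
move=> x; apply: (@cvgM R[i]); exact: dual_continuous.
Qed.

Definition dual_mul (w1 w2 : dual) : dual :=
  @Dual (fun x => w1 x * w2 x) (mul_norm w1 w2) (@mulD w1 w2)
    (@mul_cont w1 w2).

Let inv_norm (w : dual) (x : G) : Normc.normc (w x)^-1 = 1.
Proof. by rewrite Normc.normcV dual_norm invr1. Qed.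

Let invD (w : dual) (x y : G) : (w (x + y))^-1 = (w x)^-1 * (w y)^-1.
Proof. by rewrite dualD invfM. Qed.

Let dual_neq0 (w : dual) (x : G) : w x != 0.
Proof.
apply/eqP => w0; have := dual_norm w x.
by rewrite w0 Normc.normc0 => /esym/eqP; rewrite oner_eq0.
Qed.

Let inv_cont (w : dual) : continuous ((fun x => (w x)^-1) : G -> R[i]^o).
Proof.
move=> x; apply: (@cvgV R[i]) => //; exact: dual_continuous.
Qed.

Definition dual_inv (w : dual) : dual :=
  @Dual (fun x => (w x)^-1) (inv_norm w) (@invD w) (@inv_cont w).

Let dual_mulA : associative dual_mul.
Proof. by move=> a b c; apply: dual_eq => x /=; rewrite mulrA. Qed.

Let dual_mul1w : left_id dual_one dual_mul.
Proof. by move=> a; apply: dual_eq => x /=; rewrite mul1r. Qed.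

Let dual_mulw1 : right_id dual_one dual_mul.
Proof. by move=> a; apply: dual_eq => x /=; rewrite mulr1. Qed.

Let dual_mulVw : left_inverse dual_one dual_inv dual_mul.
Proof. by move=> a; apply: dual_eq => x /=; rewrite mulVf. Qed.

Let dual_mulwV : right_inverse dual_one dual_inv dual_mul.
Proof. by move=> a; apply: dual_eq => x /=; rewrite mulfV. Qed.

HB.instance Definition _ :=
  isGroup.Build dual dual_mulA dual_mul1w dual_mulw1 dual_mulVw dual_mulwV.

HB.instance Definition _ := isPointed.Build dual dual_one.

End dual.

Section fourier.
Context (R : realType) (G : topologicalZmodType).
Variable mu : {measure set (borel G) -> \bar R}.
Variable nu : {measure set (borel (dual R G)) -> \bar R}.

Definition fourier (f : G -> R[i]) (w : dual R G) : R[i] :=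
  cintegral mu (fun x => f x * conjc (w x)).

(* The Plancherel measure relative to [mu] is the Haar measure of the dual for
   which the Fourier transform is isometric for the L^2 norms. *)
Definition is_plancherel :=
  is_haar (fun w1 w2 : dual R G => (w1 * w2)%g) nu /\
  forall f : G -> R[i], isL1 mu f -> isL2 mu f ->
    (\int[nu]_w (sqnormc (fourier f w))%:E =
     \int[mu]_x (sqnormc (f x))%:E)%E.

(* [h] represents the image of [f] under the continuous extension to L^2 of the
   Fourier transform on the intersection of L^1 and L^2. *)
Definition is_fourier_plancherel (f : G -> R[i]) (h : dual R G -> R[i]) :=
  [/\ isL2 mu f, isL2 nu h &
      exists u : nat -> G -> R[i],
        [/\ forall n, isL1 mu (u n) /\ isL2 mu (u n),
            L2dist2 mu (u n) f @[n --> \oo] --> 0%E &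
            L2dist2 nu (fourier (u n)) h @[n --> \oo] --> 0%E]].

(* A chosen representative of a class that is unique up to a.e. equality; the
   default value is never used when [mu] is a Haar measure on a locally compact
   group, [nu] its Plancherel measure and [f] is square integrable. *)
Definition fourier_plancherel (f : G -> R[i]) : dual R G -> R[i] :=
  xget (cst 0) [set h | is_fourier_plancherel f h].

(* The support of a function defined up to a.e. equality: the complement of the
   largest open set on which it vanishes a.e. *)
Definition ess_support (h : dual R G -> R[i]) : set (dual R G) :=
  [set w | forall U : set (dual R G), open U -> U w ->
     ~ h = cst 0 %[ae nu in U]].

Definition null_closed (E : set (dual R G)) := closed E /\ nu E = 0%E.

Definition in_DE (E : set (dual R G)) (f : G -> R[i]) :=
  [/\ isL2 mu f,
      (ess_sup nu (fun w => (Normc.normc (fourier_plancherel f w))%:E) < +oo)%E,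
      compact (ess_support (fourier_plancherel f)) &
      ess_support (fourier_plancherel f) `<=` ~` E].

Definition locally_integrable (A : set (dual R G)) (F : dual R G -> \bar R) :=
  forall K : set (dual R G), compact K -> K `<=` A -> nu.-integrable K F.

End fourier.

Section subgroups.
Context (R : realType) (G : topologicalZmodType).

Section subgroup_types.
Variable S : zmodClosed G.

Definition subgroup_type : Type := {x : G | x \in S}.

HB.instance Definition _ := [isSub of subgroup_type for @sval _ _].
HB.instance Definition _ := [Choice of subgroup_type by <:].
HB.instance Definition _ := [SubChoice_isSubZmodule of subgroup_type by <:].
HB.instance Definition _ :=
  Topological.copy subgroup_type
    (initial_topology (val : subgroup_type -> G)).
HB.instance Definition _ := isPointed.Build subgroup_type 0.

Definition quotient_group : Type := quotient_topology (Quotient.quot S).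

HB.instance Definition _ := Topological.on quotient_group.
HB.instance Definition _ := Quotient.on quotient_group.
HB.instance Definition _ := GRing.Zmodule.copy quotient_group (Quotient.quot S).
HB.instance Definition _ := isPointed.Build quotient_group 0.

Definition annihilator : set (dual R G) :=
  [set w | forall x, x \in S -> w x = 1].

End subgroup_types.

Definition weil (mu : {measure set (borel G) -> \bar R}) (S : zmodClosed G)
    (muS : {measure set (borel (subgroup_type S)) -> \bar R})
    (muQ : {measure set (borel (quotient_group S)) -> \bar R}) :=
  forall f : borel G -> \bar R, measurable_fun setT f ->
    (forall x, (0 <= f x)%E) ->
    (\int[mu]_x f x = \int[muQ]_q \int[muS]_g f (repr q + val g)%R)%E.

(* In [cs_counting], discreteness together with [cs_cocompact] says that the
   subgroup is a uniform lattice. *)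
Record cocompact_subgroup (mu : {measure set (borel G) -> \bar R}) :=
  CocompactSubgroup {
    cs_group :> zmodClosed G ;
    cs_closed : closed [set x | x \in cs_group] ;
    cs_cocompact : compact [set: quotient_group cs_group] ;
    cs_haar : {measure set (borel (subgroup_type cs_group)) -> \bar R} ;
    cs_haarP : is_haar (fun x y : subgroup_type cs_group => x + y) cs_haar ;
    cs_counting : (forall A : set (subgroup_type cs_group), open A) ->
      forall A, cs_haar A = counting A ;
    cs_quotient : {measure set (borel (quotient_group cs_group)) -> \bar R} ;
    cs_quotientP : is_haar (fun x y : quotient_group cs_group => x + y) cs_quotient ;
    cs_weil : weil mu cs_haar cs_quotient }.

(* The measure is finite, being a Haar measure on a compact group. *)
Definition covolume mu (S : cocompact_subgroup mu) : R :=
  fine (cs_quotient S setT).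

End subgroups.

Arguments annihilator R {G} S.

Record gti_system (R : realType) (G : topologicalZmodType)
    (mu : {measure set (borel G) -> \bar R}) (J : countType) := GTISystem {
  gti_group : J -> cocompact_subgroup mu ;
  gti_disp : J -> measure_display ;
  gti_index : forall j, measurableType (gti_disp j) ;
  gti_measure : forall j, {sigma_finite_measure set (gti_index j) -> \bar R} ;
  gti_gen : forall j, gti_index j -> G -> R[i] ;
  gti_L2 : forall j p, isL2 mu (@gti_gen j p) ;
  gti_measurable : forall j, measurable_fun setT
    (@gti_gen j : gti_index j -> g_sigma_algebraType (@L2open _ (borel G) R mu)) ;
  gti_joint : forall j, cmeasurable
    (fun z : (gti_index j * borel G)%type => @gti_gen j z.1 z.2) }.

Section conditions.
Context (R : realType) (G : topologicalZmodType) (J : countType).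
Variable mu : {measure set (borel G) -> \bar R}.
Variable nu : {measure set (borel (dual R G)) -> \bar R}.
Variable Psi : gti_system mu J.
Variable E : set (dual R G).

Local Notation Gam j := (gti_group Psi j).
Local Notation P j := (gti_index Psi j).
Local Notation muP j := (gti_measure Psi j).
Local Notation g j p := (@gti_gen _ _ _ _ Psi j p).

Definition local_integrability_condition :=
  forall f, in_DE mu nu E f ->
    (\esum_(j in [set: J]) (((covolume (Gam j))^-1)%:E *
      \int[muP j]_p \esum_(a in annihilator R (Gam j))
        \int[nu]_(w in ess_support nu (fourier_plancherel mu nu f))
          (sqnormc (fourier_plancherel mu nu f (w * a)%g *
                    fourier_plancherel mu nu (g j p) w))%:E) < +oo)%E.

(* The transforms of the generators are classes modulo a.e. equality, so that
   their integral in [p] at a fixed [w] is only meaningful once they are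
   represented by a function that is measurable in [(p, w)]. Such a function
   exists for every GTI system, and by Tonelli's theorem two of them give
   integrals in [p] that agree for almost every [w]. *)
Definition joint_transform (h : forall j, P j -> dual R G -> R[i]) :=
  forall j,
    cmeasurable (fun z : (P j * borel (dual R G))%type => h j z.1 z.2) /\
    forall p, h j p = fourier_plancherel mu nu (g j p) %[ae nu].

Definition calderon_integrability_condition :=
  exists2 h, joint_transform h &
    locally_integrable nu (~` E) (fun w =>
      \esum_(j in [set: J]) (((covolume (Gam j))^-1)%:E *
        \int[muP j]_p (sqnormc (h j p w))%:E))%E.

Definition strictly_temperate :=
  exists2 h, joint_transform h &
    locally_integrable nu (~` E) (fun w =>
      \esum_(j in [set: J]) \int[muP j]_p (sqnormc (h j p w))%:E)%E.

Definition uniform_counting_estimate :=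
  forall K : set (dual R G), compact K ->
    exists2 C : R, 0 < C &
      forall j,
        (ereal_sup (range (fun w : dual R G =>
           \esum_(a in annihilator R (Gam j)) (\1_K (w * a)%g)%:E)) <=
         (C * (1 + covolume (Gam j)))%:E)%E.

End conditions.

(* Main.v *)
(* Fix f in D_E(G) and let K be the essential support of its transform F, so that
   |F|^2 <= B 1_K almost everywhere. The counting estimate then bounds the sum
   over alpha of the integrals of |F(w alpha) g(w)|^2 over K by
   B C (1 + d(Gamma_j)) times the integral of |g|^2 over K. Dividing by
   d(Gamma_j) turns 1 + d(Gamma_j) into 1/d(Gamma_j) + 1: by Tonelli's theorem
   the first summand is controlled by the Calderon condition on the compact set
   K and the second one by strict temperateness.

   That F vanishes almost everywhere off K rests on a Lindelof argument: if G is
   second countable, then its dual with the compact-open topology has a countable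
   network, given by the finite intersections of the sets {w | w(U) <= V}
   with U and V in countable bases. *)
Require Import Defs.
From mathcomp Require Import all_boot all_order all_algebra.
From mathcomp Require Import all_classical all_reals all_analysis.
From mathcomp Require Import measurable_realfun ess_sup_inf complex ring lra.

Set Implicit Arguments.
Unset Strict Implicit.
Unset Printing Implicit Defensive.

Import Order.TTheory GRing.Theory Num.Theory.
Import numFieldNormedType.Exports.
Import ComplexField.

Local Open Scope classical_set_scope.
Local Open Scope ring_scope.

(** * Discs in the complex plane and the compact-open topology of the dual *)

Lemma ball_normcE (R : realType) (z y : R[i]^o) (r : R) :
  ball z r%:C%C y = (Normc.normc (z - y) < r) :> Prop.
Proof.
by rewrite -ball_normE /= -[`|_|]/((Normc.normc _)%:C%C) ltcE /= eqxx.
Qed.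

Lemma nbhs_normcP (R : realType) (z : R[i]^o) (U : set R[i]^o) :
  nbhs z U <->
  exists2 r : R, 0 < r & [set y : R[i] | Normc.normc (z - y) < r] `<=` U.
Proof.
split=> [/nbhs_ballP[[r s] /=]|[r r0 zrU]].
- rewrite ltcE /= => /andP[/eqP-> r0] zrU.
  by exists r => // y zy; apply: zrU; rewrite ball_normcE.
- apply/nbhs_ballP; exists r%:C%C => /=; first by rewrite ltcR.
  by move=> y; rewrite ball_normcE; exact: zrU.
Qed.

Lemma normc_le_ReIm (R : realType) (x y : R) :
  Normc.normc (Complex x y) <= `|x| + `|y|.
Proof.
rewrite /= -[leRHS]ger0_norm ?addr_ge0// -sqrtr_sqr ler_wsqrtr//.
by rewrite sqrrD !real_normK ?num_real// addrAC lerDl mulrn_wge0// mulr_ge0.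
Qed.

Lemma complex_countable_nbhs (R : realType) :
  exists O : rat * rat * nat -> set R[i]^o,
    forall (z : R[i]^o) (U : set R[i]^o), nbhs z U ->
      exists i, nbhs z (O i) /\ O i `<=` U.
Proof.
pose c (i : rat * rat * nat) : R[i] := Complex (ratr i.1.1) (ratr i.1.2).
exists (fun i => [set y : R[i] | Normc.normc (c i - y) < i.2.+1%:R^-1]).
move=> [x y] U /nbhs_normcP[r r0 zrU].
have r20 : 0 < r / 2 by rewrite divr_gt0.
(* The disc has radius [s < r / 2] and a rational centre within [s] of the point, so it contains the
   point and all its elements lie within [2 s < r] of it. *)
have [n _ /(_ n (leqnn n)) /= nr] := near_infty_natSinv_lt (PosNum r20).
set s : R := n.+1%:R^-1 in nr.
have s0 : 0 < s by rewrite invr_gt0.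
have rat_near (t : R) : exists q : rat, `|ratr q - t| < s / 2.
  have [q] := @rat_in_itvoo R (t - s / 2) (t + s / 2) (ltac:(lra)).
  rewrite in_itv/= => /andP[q1 q2]; exists q.
  by rewrite ltr_norml; apply/andP; split; lra.
have [p px] := rat_near x; have [q qy] := rat_near y.
have cz : Normc.normc (c (p, q, n) - Complex x y) < s.
  apply: le_lt_trans (normc_le_ReIm _ _) _.
  by rewrite [ltRHS]splitr ltrD.
have triangle (u v w : R[i]) :
    Normc.normc (u - w) <= Normc.normc (u - v) + Normc.normc (v - w).
  have -> : u - w = (u - v) + (v - w) by rewrite addrA subrK.
  exact: le_normcD.
exists (p, q, n); split => /=.
  apply/nbhs_normcP; exists (s - Normc.normc (c (p, q, n) - Complex x y)).
    by rewrite subr_gt0.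
  move=> w /= zw; apply: le_lt_trans (triangle _ (Complex x y) _) _.
  by rewrite -ltrBrDl.
move=> w /= cw; apply: zrU => /=.
apply: le_lt_trans (triangle _ (c (p, q, n)) _) _.
rewrite [ltRHS]splitr ltrD// ?(lt_trans cw)// -normcN opprB.
exact: lt_trans nr.
Qed.

(** Near a continuous function, compact-open convergence is uniform convergence on compact sets.
    Radii in [R[i]] are complex, but a positive one is real, so real [e] suffice. *)
Lemma compact_open_normcP (R : realType) (T : topologicalType)
  (f : T -> R[i]^o) (F : set_system (T -> R[i]^o)) :
  continuous f -> Filter F ->
  {compact-open, F --> f} <->
  (forall K, compact K -> forall e : R, 0 < e ->
     F [set h : T -> R[i] | forall x, K x -> Normc.normc (f x - h x) < e]).
Proof.
move=> cf FF; rewrite compact_open_fam_compactP//; split.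
  move=> /(fam_cvgP compact) Ff K cK e e0; apply: (Ff K cK).
  apply/uniform_nbhs.
  exists [set xy : R[i]^o * R[i]^o | ball xy.1 e%:C%C xy.2]; split.
    rewrite -entourage_from_ballE; exists e%:C%C => //=.
    by rewrite ltcR.
  by move=> h fh x Kx; have := fh x Kx; rewrite /= ball_normcE.
move=> Ff; apply/(fam_cvgP compact) => K cK P /uniform_nbhs[E [+ EP]].
rewrite -entourage_from_ballE => -[[r s] /= + rsE].
rewrite ltcE /= => /andP[/eqP s0 r0].
apply: (filterS EP); apply: filterS (Ff K cK r r0) => h fh x Kx.
by apply: rsE; rewrite /= s0 ball_normcE; exact: fh.
Qed.

(** Since [a] has modulus 1, multiplying by it preserves uniform distances on every compact set. *)
Lemma dual_mul_continuous (R : realType) (G : topologicalZmodType)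
  (a : dual R G) : continuous (fun w : dual R G => (a * w)%g).
Proof.
apply: continuous_comp_initial => w.
apply: (iffRL (compact_open_normcP (@dual_continuous _ _ (a * w)%g) _));
  last move=> K cK e e0.
  by apply: fmap_filter; exact: nbhs_filter.
have wK : nbhs w [set v : dual R G |
    forall x, K x -> Normc.normc (w x - v x) < e].
  exact: (iffLR (compact_open_normcP (@dual_continuous _ _ w)
    (fmap_filter (@dual_compact_open R G) (nbhs_filter w)))
    (@initial_continuous _ _ (@dual_compact_open R G) w) K cK e e0).
apply: (@filterS _ _ (nbhs_filter w) _ _ _ wK) => v wv x Kx /=.
by rewrite -mulrBr Normc.normcM dual_norm mul1r; exact: wv.
Qed.

(** The sets [M s] that contain [w] generate a filter converging to [w] in the compact-open
    topology, so one of them lies in any given neighbourhood. *)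
Lemma dual_network (R : realType) (G : topologicalZmodType) :
  @second_countable G ->
  exists (I : countType) (N : I -> set (dual R G)), forall (U : set (dual R G)) w,
    open U -> U w -> exists n, N n w /\ N n `<=` U.
Proof.
move=> [B /countable_injP[f injf] [Bopen Bbase]].
pose b n := xget set0 [set U : set G | B U /\ f U = n].
have bE U : B U -> b (f U) = U.
  move=> BU; rewrite /b; case: xgetP => [V -> [BV fVU]|/(_ U)]; last by case.
  by apply: injf => //; rewrite inE.
have [base Obase] := complex_countable_nbhs R.
pose I := (nat * (rat * rat * nat))%type.
pose M (s : seq I) : set (G -> R[i]) :=
  [set h | forall i, i \in s -> forall x, b i.1 x -> base i.2 (h x)].
exists (seq I : countType), (fun s => [set w : dual R G | M s w]).
move=> U w [V oV <-] /= Vw.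
suff [s [Msw sV]] : exists s, M s w /\ M s `<=` V.
  by exists s; split => // v; exact: sV.
pose F : set_system (G -> R[i]) := filter_from [set s | M s w] M.
have FF : Filter F.
  apply: filter_from_filter; first by exists [::].
  move=> s t Ms Mt; exists (s ++ t).
    by move=> i; rewrite mem_cat => /orP[/Ms|/Mt].
  by move=> h Mh; split=> i ist; apply: Mh; rewrite mem_cat ist ?orbT.
suff : {compact-open, F --> (w : G -> R[i]^o)}.
  by move=> /(_ V); case; [exact: open_nbhs_nbhs|move=> s ? ?; exists s].
apply: (iffRL (@compact_open_cvgP G R[i]^o F (w : G -> R[i]) FF)) => K W.
rewrite compact_cover => cK oW wKW.
(* By continuity of [w] the basic sets indexed by [D] cover [K]. A finite subcover is a list [s]
   such that every [h] in [M s] still maps [K] into [W]. *)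
pose D : set I := [set i | [/\ open (b i.1),
  (forall x, b i.1 x -> base i.2 (w x)) & base i.2 `<=` W]].
have [|x Kx|s sD Ks] := cK I D (fun i => b i.1).
- by move=> i [].
- have [|j [wxj jW]] := Obase (w x) W.
    by apply: open_nbhs_nbhs; split => //; apply: wKW; exists x.
  have [A [BA Ax] Aj] := Bbase x _ (@dual_continuous _ _ w x _ wxj).
  exists (f A, j); last by rewrite /= bE.
  by split; rewrite /= ?bE//; exact: Bopen.
- exists (finmap.enum_fset s); first by move=> i /sD; rewrite inE => -[].
  move=> h Mh _ [x Kx <-]; have [i si bix] := Ks x Kx.
  have := sD i si; rewrite inE => -[_ _]; apply; exact: Mh.
Qed.

(** * Sums and integrals of nonnegative extended real functions *)

Section integrals.
Local Open Scope ereal_scope.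
Context (R : realType).

Lemma esumZl_le (I : choiceType) (S : set I) (x : \bar R) (a : I -> \bar R) :
  0 <= x -> (forall i, 0 <= a i) ->
  \esum_(i in S) (x * a i) <= x * \esum_(i in S) a i.
Proof.
move=> x0 a0; apply: ge_ereal_sup => _ [A finA <-].
rewrite -ge0_mule_fsumr//; apply: lee_wpmul2l => //.
by apply: ereal_sup_ubound; exists A.
Qed.

(* The integral of a nonnegative function is a supremum over the simple functions
   below it, so no measurability is involved. *)
Lemma ge0_le_integral_nonmeasurable d (T : measurableType d)
  (mu : {measure set T -> \bar R}) (D : set T) (f g : T -> \bar R) :
  (forall x, D x -> 0 <= f x) -> (forall x, D x -> f x <= g x) ->
  \int[mu]_(x in D) f x <= \int[mu]_(x in D) g x.
Proof.
move=> f0 fg; have g0 x : D x -> 0 <= g x.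
  by move=> Dx; exact: le_trans (f0 _ Dx) (fg _ Dx).
rewrite !ge0_integralE//; apply: ereal_sup_le => _ [h hf <-].
exists h => // x; apply: le_trans (hf x) _.
by rewrite /patch; case: ifPn => // /set_mem; exact: fg.
Qed.

(** Finite partial sums commute with the integral and lie below the full sum. The index set may be
    uncountable, so this covers sums over an annihilator. *)
Lemma esum_integral_le d (T : measurableType d)
  (mu : {measure set T -> \bar R}) (D : set T) (I : choiceType) (S : set I)
  (f : I -> T -> \bar R) :
  measurable D -> (forall i, measurable_fun D (f i)) ->
  (forall i x, 0 <= f i x) ->
  \esum_(i in S) \int[mu]_(x in D) f i x <=
  \int[mu]_(x in D) \esum_(i in S) f i x.
Proof.
move=> mD mf f0; apply: ge_ereal_sup => _ [A [finA AS] <-].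
rewrite -ge0_integral_fsum//; apply: ge0_le_integral_nonmeasurable => x Dx.
  by apply: fsume_ge0 => i _; exact: f0.
by apply: ereal_sup_ubound; exists A.
Qed.

(** Tonelli's theorem is applied to [m], the restriction of [m2] to [K], which is a finite measure;
    an indicator of [K] in the integrand turns integrals over [K] into integrals over the whole
    space. *)
Lemma tonelli_finite_set d1 d2 (T1 : measurableType d1) (T2 : measurableType d2)
  (m1 : {sigma_finite_measure set T1 -> \bar R})
  (m2 : {measure set T2 -> \bar R}) (K : set T2) (f : T1 * T2 -> \bar R) :
  measurable K -> m2 K < +oo -> measurable_fun setT f -> (forall z, 0 <= f z) ->
  [/\ measurable_fun setT (fun x => \int[m2]_(y in K) f (x, y)),
      measurable_fun setT (fun y => \int[m1]_x f (x, y)) &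
      \int[m1]_x \int[m2]_(y in K) f (x, y) =
      \int[m2]_(y in K) \int[m1]_x f (x, y)].
Proof.
move=> mK Koo mf f0; pose m := mfrestr mK Koo.
have mE (g : T2 -> \bar R) :
    \int[m2]_(y in K) g y = \int[m]_y (g y * (\1_K y)%:E).
  rewrite (eq_measure_integral m) => [|A _ AK]; last first.
    by rewrite /= /mfrestr /mrestr setIidl.
  by rewrite integral_mkcond epatch_indic.
pose h (z : T1 * T2) := f z * (\1_K z.2)%:E.
have h0 z : 0 <= h z by rewrite mule_ge0// lee_fin.
have mh : measurable_fun setT h.
  apply: emeasurable_funM => //; apply/measurable_EFinP.
  by apply: measurableT_comp => //; exact: measurable_indic.
split.
- under eq_fun do rewrite mE.
  exact: (measurable_fun_fubini_tonelli_F (m2 := m) h).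
- exact: (measurable_fun_fubini_tonelli_G (m1 := m1) f).
- transitivity (\int[m1]_x \int[m]_y h (x, y)).
    by apply: eq_integral => x _; rewrite mE.
  rewrite (fubini_tonelli (m1 := m1) (m2 := m) h)// mE.
  apply: eq_integral => y _; rewrite /h /=.
  have [yK|yK] := boolP (y \in K).
    by rewrite indicE yK mule1; under eq_integral do rewrite mule1.
  rewrite indicE (negbTE yK) mule0.
  by under eq_integral do rewrite mule0; rewrite integral0.
Qed.

End integrals.

(** * The squared modulus *)

Section complex.
Context (R : realType).

Lemma sqnormcM (x y : R[i]) : sqnormc (x * y) = sqnormc x * sqnormc y.
Proof. by rewrite /sqnormc Normc.normcM exprMn. Qed.

Lemma sqnormc_ge0 (x : R[i]) : 0 <= sqnormc x.
Proof. exact: sqr_ge0. Qed.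

Lemma sqnormcE (x : R[i]) : sqnormc x = complex.Re x ^+ 2 + complex.Im x ^+ 2.
Proof. by case: x => a b; rewrite /sqnormc /= sqr_sqrtr// addr_ge0// sqr_ge0. Qed.

Lemma measurable_sqnormc d (T : measurableType d) (f : T -> R[i]) :
  cmeasurable f -> measurable_fun setT (fun x => (sqnormc (f x))%:E).
Proof.
move=> [mRe mIm]; apply/measurable_EFinP; under eq_fun do rewrite sqnormcE.
by apply: measurable_funD; exact: measurable_funX.
Qed.

End complex.

(** * Translations, null sets and essential supports on the dual *)

Section haar.
Context (R : realType) (G : topologicalZmodType).
Variable nu : {measure set (borel (dual R G)) -> \bar R}.
Hypothesis nu_haar : is_haar (fun w1 w2 : dual R G => (w1 * w2)%g) nu.

Lemma dual_mulC : commutative (fun w1 w2 : dual R G => (w1 * w2)%g).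
Proof. by move=> w1 w2; apply: dual_eq => x /=; rewrite mulrC. Qed.

Lemma measurable_closed (K : set (dual R G)) :
  closed K -> measurable (K : set (borel (dual R G))).
Proof.
move=> cK; rewrite -[K]setCK; apply: measurableC.
by apply: sub_sigma_algebra; exact: closed_openC.
Qed.

Lemma measurable_dual_mulr (a : dual R G) :
  measurable_fun setT
    (fun w : borel (dual R G) => ((w : dual R G) * a)%g : borel (dual R G)).
Proof.
apply: (@measurability _ _ (borel (dual R G)) (borel (dual R G)) setT _
  (@open (dual R G))) => // _ [U oU <-].
rewrite setTI; apply: sub_sigma_algebra.
have /continuousP /(_ U oU) := @dual_mul_continuous R G a.
by congr open; apply/seteqP; split => w /=; rewrite dual_mulC.
Qed.

Lemma ae_dual_sub (P Q : dual R G -> Prop) : (forall w, P w -> Q w) ->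
  {ae nu, forall w, P w} -> {ae nu, forall w, Q w}.
Proof. by move=> PQ; apply: (@filterS _ (almost_everywhere nu)). Qed.

(** By invariance of [nu], a translate of an exceptional null set is again null. *)
Lemma ae_dual_mulr (a : dual R G) (P : dual R G -> Prop) :
  {ae nu, forall w, P w} -> {ae nu, forall w, P (w * a)%g}.
Proof.
move=> [N [mN N0 PN]]; exists ((fun w => (a * w)%g) @^-1` N).
have [_ _ nu_inv] := nu_haar.
split; last by move=> w /=; rewrite dual_mulC => /PN.
- have -> : (fun w : dual R G => (a * w)%g) = (fun w => (w * a)%g).
    by apply/funext => w; exact: dual_mulC.
  by have := measurable_dual_mulr a measurableT mN; rewrite setTI.
- exact: etrans (nu_inv a N mN) N0.
Qed.

Lemma closed_ess_support (h : dual R G -> R[i]) : closed (ess_support nu h).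
Proof.
rewrite -[ess_support _ _]setCK closedC openE => w /existsNP[U].
move=> /not_implyP[oU /not_implyP[Uw /contrapT hU]].
apply: (@filterS _ _ _ U); last exact: open_nbhs_nbhs.
by move=> v Uv; apply/existsNP; exists U => /(_ oU Uv); exact.
Qed.

Lemma ae_eq0_off_ess_support (h : dual R G -> R[i]) :
  @second_countable G -> {ae nu, forall w, ~ ess_support nu h w -> h w = 0}.
Proof.
move=> /(@dual_network R)[I [N Nnet]].
(* Countability enters here: one null set per network member, indexed by [nat] through
   [unpickle]. *)
have : {ae nu, forall w, forall n, if unpickle n is Some i then
    forall U : set (dual R G), h = cst 0 %[ae nu in U] -> N i `<=` U ->
      N i w -> h w = 0
    else True}.
  apply: ae_foralln => n; case: (unpickle n) => [i|]; last exact: aeW.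
  (* The conclusion [h w = 0] does not mention [U], so the null set of a single [U] containing [N i]
     serves for all of them. *)
  have [[U [hU NU]]|noU] := pselect (exists U : set (dual R G),
      h = cst 0 %[ae nu in U] /\ N i `<=` U).
    by apply: ae_dual_sub hU => w hw V _ _ /NU; exact: hw.
  by apply: aeW => w U hU NU; case: noU; exists U.
apply: ae_dual_sub => w hw /existsNP[U].
move=> /not_implyP[oU /not_implyP[Uw /contrapT hU]].
have [i [Niw NU]] := Nnet U w oU Uw.
by have := hw (pickle i); rewrite pickleK; apply; [exact: hU| |].
Qed.

End haar.

(** * Bounds for the transforms of the generators *)

Section gti.
Context (R : realType) (G : topologicalZmodType).
Variable mu : {measure set (borel G) -> \bar R}.
Variable nu : {measure set (borel (dual R G)) -> \bar R}.
Hypothesis nu_haar : is_haar (fun w1 w2 : dual R G => (w1 * w2)%g) nu.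

(** Either outcome of the choice is measurable: a representative is square integrable, and the
    default is the zero function. *)
Lemma cmeasurable_fourier_plancherel (f : G -> R[i]) :
  cmeasurable (fourier_plancherel mu nu f : borel (dual R G) -> R[i]).
Proof.
rewrite /fourier_plancherel; case: xgetP => [h _ [_ [mh _] _]|_]; first exact: mh.
by split; exact: measurable_cst.
Qed.

Lemma cmeasurable_dual_mulr (F : borel (dual R G) -> R[i]) (a : dual R G) :
  cmeasurable F ->
  cmeasurable (fun w : borel (dual R G) => F ((w : dual R G) * a)%g).
Proof.
by move=> [mRe mIm]; split;
  [exact: (measurableT_comp mRe (measurable_dual_mulr a))
  |exact: (measurableT_comp mIm (measurable_dual_mulr a))].
Qed.

Lemma in_DE_sqnormc_le (E : set (dual R G)) (f : G -> R[i]) :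
  @second_countable G -> in_DE mu nu E f ->
  exists2 B : R, 0 <= B &
    {ae nu, forall w, sqnormc (fourier_plancherel mu nu f w) <=
       B * \1_(ess_support nu (fourier_plancherel mu nu f)) w}.
Proof.
move=> G2 [_ /ess_supr_bounded[M FM] _ _]; exists (M ^+ 2); first exact: sqr_ge0.
have := ae_eq0_off_ess_support nu (fourier_plancherel mu nu f) G2.
move: FM; set F := fourier_plancherel mu nu f => FM F0.
suff : {ae nu, forall w, Normc.normc (F w) <= M /\
    (~ ess_support nu F w -> F w = 0)}.
  apply: ae_dual_sub => w [FwM Fw0].
  have [Kw|Kw] := pselect (ess_support nu F w).
    rewrite indicE mem_set// mulr1 /sqnormc lerXn2r ?nnegrE//.
      by case: (F w) => x y; exact: sqrtr_ge0.
    by apply: le_trans FwM; case: (F w) => x y; exact: sqrtr_ge0.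
  by rewrite Fw0// /sqnormc Normc.normc0 expr0n mulr_ge0// sqr_ge0.
exact: (@filterI _ (almost_everywhere nu)).
Qed.

(** Once [F] is replaced by its bound on [K], the sum moves under the integral, where it counts the
    translates of [w] that fall in [K]; there are at most [c]. *)
Lemma esum_translates_le (F g : borel (dual R G) -> R[i]) (K A : set (dual R G))
    (B c : R) :
  cmeasurable F -> cmeasurable g -> closed K -> 0 <= B ->
  {ae nu, forall w : dual R G, sqnormc (F w) <= B * \1_K w} ->
  (forall w : dual R G, \esum_(a in A) (\1_K (w * a)%g)%:E <= c%:E)%E ->
  (\esum_(a in A) \int[nu]_(w in K)
      (sqnormc (F ((w : dual R G) * a)%g * g w))%:E <=
   (B * c)%:E * \int[nu]_(w in K) (sqnormc (g w))%:E)%E.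
Proof.
move=> mF mg /measurable_closed mK B0 FB Ac.
pose t (a : dual R G) (w : borel (dual R G)) : \bar R :=
  ((B * \1_K ((w : dual R G) * a)%g)%:E * (sqnormc (g w))%:E)%E.
have mind (a : dual R G) : measurable_fun setT
    (fun w : borel (dual R G) => \1_K ((w : dual R G) * a)%g : R).
  have mK1 : measurable_fun setT (\1_K : borel (dual R G) -> R).
    exact: measurable_indic.
  exact: (measurableT_comp mK1 (measurable_dual_mulr a)).
have t0 a w : (0 <= t a w)%E.
  by rewrite /t -EFinM lee_fin mulr_ge0 ?sqnormc_ge0// mulr_ge0.
have mt a : measurable_fun (K : set (borel (dual R G))) (t a).
  apply: measurable_funTS; apply: emeasurable_funM; last exact: measurable_sqnormc.
  by apply/measurable_EFinP; apply: measurable_funM.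
(* The counting bound at the trivial character already forces [c] to be nonnegative. *)
have c0 : 0 <= c.
  rewrite -lee_fin; apply: le_trans (Ac (dual_one R G)).
  by apply: esum_ge0 => a _; rewrite lee_fin.
(* The null set off which the bound on [F] holds at [w * a] depends on [a], so the bound is used in
   each integral separately, before the interchange. *)
apply: (@le_trans _ _ (\esum_(a in A) \int[nu]_(w in K) t a w)%E).
  apply: le_esum => a _; apply: ae_ge0_le_integral => //.
  - by move=> w _; rewrite lee_fin sqnormc_ge0.
  - apply: measurable_funTS; under eq_fun do rewrite sqnormcM EFinM.
    apply: emeasurable_funM; apply: measurable_sqnormc => //.
    exact: cmeasurable_dual_mulr.
  - apply: ae_dual_sub (ae_dual_mulr nu_haar a FB) => w Fw _.
    by rewrite /t -EFinM lee_fin sqnormcM ler_wpM2r// sqnormc_ge0.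
apply: le_trans (esum_integral_le nu A mK mt t0) _.
rewrite -ge0_integralZl_EFin//; first last.
- exact: mulr_ge0.
- by apply: measurable_funTS; exact: measurable_sqnormc.
- by move=> w _; rewrite lee_fin sqnormc_ge0.
apply: ge0_le_integral_nonmeasurable => w _.
  by apply: esum_ge0 => a _.
have tE a : t a w = ((B * sqnormc (g w))%:E * (\1_K ((w : dual R G) * a)%g)%:E)%E.
  by rewrite /t -!EFinM mulrAC.
under eq_esum do rewrite tE.
have Bg0 : (0 <= (B * sqnormc (g w))%:E)%E.
  by rewrite lee_fin mulr_ge0// sqnormc_ge0.
apply: (@le_trans _ _ ((B * sqnormc (g w))%:E *
    \esum_(a in A) (\1_K ((w : dual R G) * a)%g)%:E)%E).
  by apply: esumZl_le => // a; rewrite lee_fin.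
by apply: le_trans (lee_wpmul2l Bg0 (Ac w)) _; rewrite -!EFinM lee_fin mulrAC.
Qed.

Variables (J : countType) (Psi : gti_system mu J).

(** For each [p], [h j p] and the chosen transform agree almost everywhere, so their integrals over
    [K] coincide. Tonelli's theorem for the jointly measurable [h] thus carries over to the chosen
    transforms. *)
Lemma tonelli_joint_transform (h : forall j, gti_index Psi j -> dual R G -> R[i])
    (K : set (dual R G)) (j : J) :
  joint_transform nu h -> closed K -> compact K ->
  [/\ measurable_fun setT (fun p : gti_index Psi j =>
        \int[nu]_(w in K) (sqnormc (fourier_plancherel mu nu (gti_gen p) w))%:E),
      measurable_fun setT (fun w : borel (dual R G) =>
        \int[gti_measure Psi j]_p (sqnormc (h j p w))%:E) &
      \int[gti_measure Psi j]_p \int[nu]_(w in K)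
        (sqnormc (fourier_plancherel mu nu (gti_gen p) w))%:E =
      \int[nu]_(w in K) \int[gti_measure Psi j]_p (sqnormc (h j p w))%:E]%E.
Proof.
move=> /(_ j)[mh hE] /measurable_closed mK cK.
have [_ /(_ K cK) Koo _] := nu_haar.
have [] := @tonelli_finite_set R _ _ _ _ (gti_measure Psi j) nu K
  (fun z => (sqnormc (h j z.1 z.2))%:E) mK Koo (measurable_sqnormc mh).
  by move=> z; rewrite lee_fin sqnormc_ge0.
have E p : (\int[nu]_(w in K) (sqnormc (h j p w))%:E =
    \int[nu]_(w in K) (sqnormc (fourier_plancherel mu nu (gti_gen p) w))%:E)%E.
  apply: ge0_ae_eq_integral => //.
  - apply: measurable_funTS; apply: measurable_sqnormc.
    have [mRe mIm] := mh.
    split; [exact: (measurableT_comp mRe (pair1_measurable p))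
           |exact: (measurableT_comp mIm (pair1_measurable p))].
  - apply: measurable_funTS; apply: measurable_sqnormc.
    exact: cmeasurable_fourier_plancherel.
  - by move=> w _; rewrite lee_fin sqnormc_ge0.
  - by move=> w _; rewrite lee_fin sqnormc_ge0.
  - by apply: ae_dual_sub (hE p) => w hw _; rewrite hw.
rewrite (funext E) => mY mI <-; split => //.
Qed.

(** The weights [b] let one argument serve twice: inverse covolumes give the Calderon condition, the
    constant 1 gives strict temperateness. *)
Lemma esum_int_transform_lty (h : forall j, gti_index Psi j -> dual R G -> R[i])
    (E K : set (dual R G)) (b : J -> R) :
  joint_transform nu h -> closed K -> compact K -> K `<=` ~` E ->
  (forall j, 0 <= b j) ->
  Defs.locally_integrable nu (~` E) (fun w => \esum_(j in [set: J])
    ((b j)%:E * \int[gti_measure Psi j]_p (sqnormc (h j p w))%:E))%E ->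
  (\esum_(j in [set: J]) ((b j)%:E *
    \int[gti_measure Psi j]_p \int[nu]_(w in K)
      (sqnormc (fourier_plancherel mu nu (gti_gen p) w))%:E) < +oo)%E.
Proof.
move=> jh clK cK KE b0 /(_ K cK KE) /integrableP[_].
apply: le_lt_trans.
have mK := measurable_closed clK.
have I0 j w : (0 <= \int[gti_measure Psi j]_p (sqnormc (h j p w))%:E)%E.
  by apply: integral_ge0 => p _; rewrite lee_fin sqnormc_ge0.
have mI j := let: And3 _ m _ := tonelli_joint_transform j jh clK cK in m.
rewrite (eq_esum (b := fun j => \int[nu]_(w in K)
    ((b j)%:E * \int[gti_measure Psi j]_p (sqnormc (h j p w))%:E))%E); last first.
  move=> j _; have [_ _ ->] := tonelli_joint_transform j jh clK cK.
  by rewrite ge0_integralZl_EFin//; exact: measurable_funTS.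
pose t j (w : borel (dual R G)) :=
  ((b j)%:E * \int[gti_measure Psi j]_p (sqnormc (h j p w))%:E)%E.
have t0 j w : (0 <= t j w)%E by rewrite mule_ge0// lee_fin.
have mt j : measurable_fun (K : set (borel (dual R G))) (t j).
  by apply: measurable_funTS; apply: emeasurable_funM.
apply: le_trans (esum_integral_le nu [set: J] mK mt t0) _.
apply: ge0_le_integral_nonmeasurable => w _; last exact: lee_abs.
exact: esum_ge0.
Qed.

End gti.

(** * Combination of the counting estimate with the two integrability conditions *)

Theorem proposition3p1 (R : realType) (G : topologicalZmodType)
  (hG2 : @second_countable G) (hGlc : locally_compact [set: G])
  (hGh : hausdorff_space G)
  (mu : {measure set (borel G) -> \bar R}) (hmu : is_haar (fun x y : G => x + y) mu)
  (nu : {measure set (borel (dual R G)) -> \bar R})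
  (hnu : is_plancherel mu nu)
  (E : set (dual R G)) (hE : null_closed nu E)
  (J : countType) (Psi : gti_system mu J)
  (hcalderon : calderon_integrability_condition nu Psi E)
  (htemperate : strictly_temperate nu Psi E)
  (hcount : uniform_counting_estimate Psi) :
  local_integrability_condition nu Psi E.
Proof.
move=> f fDE; have [nu_haar _] := hnu.
have [B B0 FB] := in_DE_sqnormc_le hG2 fDE.
have [_ _ cK KE] := fDE.
move: FB cK KE; set F := fourier_plancherel mu nu f; set K := ess_support nu F.
move=> FB cK KE.
have clK : closed K by exact: closed_ess_support.
have mF : cmeasurable (F : borel _ -> _) :=
  cmeasurable_fourier_plancherel mu nu f.
have [C C0 hC] := hcount K cK.
pose d j := covolume (gti_group Psi j).
have d0 j : 0 <= d j by rewrite fine_ge0.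
pose Y j : \bar R := (\int[gti_measure Psi j]_p \int[nu]_(w in K)
  (sqnormc (fourier_plancherel mu nu (gti_gen p) w))%:E)%E.
have Y0 j : (0 <= Y j)%E.
  by do 2![apply: integral_ge0 => ? _]; rewrite lee_fin sqnormc_ge0.
(* The two conditions may come with different representatives [h1] and [h2]; both are reduced to the
   same integrals [Y j]. *)
have [h1 jh1 ih1] := hcalderon; have [h2 jh2 ih2] := htemperate.
have S1 : (\esum_(j in [set: J]) ((d j)^-1%:E * Y j) < +oo)%E.
  apply: (esum_int_transform_lty nu_haar jh1 clK cK KE (b := fun j => (d j)^-1)) => // j.
  by rewrite invr_ge0.
have S2 : (\esum_(j in [set: J]) (1%:E * Y j) < +oo)%E.
  apply: (esum_int_transform_lty nu_haar jh2 clK cK KE (b := fun=> 1)) => //.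
  by under eq_fun do under eq_esum do rewrite mul1e.
apply: (@le_lt_trans _ _
  ((B * C)%:E * (\esum_(j in [set: J]) ((d j)^-1%:E * Y j) +
                 \esum_(j in [set: J]) (1%:E * Y j)))%E); last first.
  apply: lte_mul_pinfty => //; first by rewrite lee_fin mulr_ge0// ltW.
  exact: lte_add_pinfty.
rewrite -esumD; [|by move=> *; rewrite mule_ge0// lee_fin invr_ge0|
                  by move=> *; rewrite mule_ge0].
apply: le_trans (esumZl_le _ _ _); last first.
- by move=> j; rewrite adde_ge0// mule_ge0// lee_fin invr_ge0.
- by rewrite lee_fin mulr_ge0// ltW.
apply: le_esum => j _.
have d'0 : 0 <= (d j)^-1 by rewrite invr_ge0.
apply: (@le_trans _ _ ((d j)^-1%:E * ((B * (C * (1 + d j)))%:E * Y j))%E).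
  apply: lee_wpmul2l; first by rewrite lee_fin.
  have [mY _ _] := tonelli_joint_transform nu_haar j jh1 clK cK.
  rewrite -ge0_integralZl_EFin//; first last.
  - by rewrite !mulr_ge0// ?addr_ge0// ltW.
  - by move=> p _; apply: integral_ge0 => w _; rewrite lee_fin sqnormc_ge0.
  apply: ge0_le_integral_nonmeasurable => p _.
    by apply: esum_ge0 => a _; apply: integral_ge0 => w _; rewrite lee_fin sqnormc_ge0.
  (* Here [c] is [C * (1 + d j)], and the supremum in the counting estimate bounds the count at each
     [w]. *)
  apply: esum_translates_le => //; first exact: cmeasurable_fourier_plancherel.
  move=> w; apply: le_trans (hC j); apply: ereal_sup_ubound.
  by exists w.
rewrite -ge0_muleDl ?lee_fin// muleA muleA -!EFinM.
apply: lee_wpmul2r => //; rewrite lee_fin.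
have -> : (d j)^-1 * (B * (C * (1 + d j))) = B * C * ((d j)^-1 + (d j)^-1 * d j).
  by ring.
have BC0 : 0 <= B * C by rewrite mulr_ge0// ltW.
apply: ler_wpM2l => //; rewrite lerD2l.
(* The product of [d j] and its inverse is at most 1 in both cases: it is 0 if [d j = 0] and 1
   otherwise. *)
have [->|dj] := eqVneq (d j) 0; first by rewrite mulr0.
by rewrite mulVf.
Qed.
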